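(* If a vertex-homogeneous finite simplicial complex $K$ has a prime number of vertices, then $K$ is minimal or $K$ is a simplex.
   Context: All simplicial complexes are finite (simplices are nonempty finite sets of vertices). A complex $K$ is vertex-homogeneous if for any two vertices $v,w\in K$ there is a simplicial automorphism $\varphi:K\to K$ with $\varphi(v)=w$. For a vertex $v$ of a complex $K$, the link $\mathrm{lk}_K(v)$ is the subcomplex of simplices $\tau\in K$ with $v\notin\tau$ and $\tau\cup\{v\}\in K$. A simplicial cone is a complex $aM$, the join of a (possibly empty) complex $M$ and a vertex $a$ not in $M$; its simplices are $\{a\}$, the simplices $\tau$ of $M$, and the sets $\{a\}\cup\tau$ with $\tau\in M$. A vertex $v$ of $K$ is dominated if $\mathrm{lk}_K(v)$ is a simplicial cone. A complex is minimal if it has no dominated vertices. ''$K$ is a simplex'' means that the set of all vertices of $K$ is a simplex of $K$. *)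

(* Defs.v *)
From mathcomp Require Import all_boot.

Set Implicit Arguments.
Unset Strict Implicit.
Unset Printing Implicit Defensive.

(* A complex is given by its set of simplices inside an ambient finite type.
   An element of T is a vertex only when its singleton is a simplex, so that
   links and cone bases are complexes over the same type. The empty family is
   the empty complex. *)
Definition is_complex (T : finType) (K : {set {set T}}) : Prop :=
  set0 \notin K /\
  (forall s t : {set T}, s \in K -> t \subset s -> t != set0 -> t \in K).

Definition vertices (T : finType) (K : {set {set T}}) : {set T} :=
  [set v | [set v] \in K].

(* Only the values of the map on the vertices matter. *)
Definition simplicial_map (T : finType) (K L : {set {set T}}) (f : T -> T) :
    Prop :=
  forall s : {set T}, s \in K -> f @: s \in L.

Definition simplicial_automorphism (T : finType) (K : {set {set T}})
    (f : T -> T) : Prop :=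
  simplicial_map K K f /\
  exists g : T -> T,
    [/\ simplicial_map K K g,
        {in vertices K, cancel f g}
      & {in vertices K, cancel g f}].

Definition vertex_homogeneous (T : finType) (K : {set {set T}}) : Prop :=
  forall v w : T, v \in vertices K -> w \in vertices K ->
    exists f : T -> T, simplicial_automorphism K f /\ f v = w.

Definition link (T : finType) (K : {set {set T}}) (v : T) : {set {set T}} :=
  [set t in K | (v \notin t) && (v |: t \in K)].

Definition cone (T : finType) (a : T) (M : {set {set T}}) : {set {set T}} :=
  [set a] |: (M :|: [set a |: t | t in M]).

Definition is_simplicial_cone (T : finType) (L : {set {set T}}) : Prop :=
  exists (a : T) (M : {set {set T}}),
    [/\ is_complex M, a \notin vertices M & L = cone a M].

Definition dominated (T : finType) (K : {set {set T}}) (v : T) : Prop :=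
  v \in vertices K /\ is_simplicial_cone (link K v).

Definition minimal_complex (T : finType) (K : {set {set T}}) : Prop :=
  forall v : T, ~ dominated K v.

Definition is_simplex (T : finType) (K : {set {set T}}) : Prop :=
  vertices K \in K.

(* Main.v *)
Require Import Defs.
From mathcomp Require Import all_boot.

(** Write [v <= w] when every simplex through [v] stays a simplex after adding
    [w]; a dominated vertex lies below a vertex other than itself.  Automorphisms
    preserve this preorder, so homogeneity gives all up-sets the same
    cardinality.  As [v <= w] makes the up-set of [w] a subset of that of [v], the two
    coincide: the preorder is symmetric, its classes are the up-sets, and their
    common size divides the prime number of vertices.  If some vertex is
    dominated that size is at least 2, so there is a single class, and a maximal
    simplex then absorbs every vertex. *)

Set Implicit Arguments.
Unset Strict Implicit.
Unset Printing Implicit Defensive.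

Section Domination.

Variables (T : finType) (K : {set {set T}}).
Hypothesis HK : is_complex K.

(** For distinct vertices this says that the link of [v] is a cone with apex [w]. *)
Definition below (v w : T) : bool :=
  [forall s in K, (v \in s) ==> (w |: s \in K)].

Definition upset (v : T) : {set T} := [set w in vertices K | below v w].

Lemma belowP (v w : T) :
  reflect (forall s, s \in K -> v \in s -> w |: s \in K) (below v w).
Proof.
apply: (iffP forall_inP) => H s sK; last by apply/implyP; apply: H.
by move/implyP: (H s sK).
Qed.

Lemma simplex_sub_vertices (s : {set T}) : s \in K -> s \subset vertices K.
Proof.
move=> sK; apply/subsetP => x xs; rewrite inE.
apply: HK.2 sK _ _; first by rewrite sub1set.
by apply/set0Pn; exists x; rewrite set11.
Qed.

Lemma below_trans (v w u : T) : below v w -> below w u -> below v u.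
Proof.
move=> /belowP vw /belowP wu; apply/belowP => s sK vs.
apply: HK.2 (wu _ (vw _ sK vs) (setU11 _ _)) _ _.
  by rewrite setUS // subsetUr.
by apply/set0Pn; exists u; rewrite setU11.
Qed.

Lemma upset_refl (v : T) : v \in vertices K -> v \in upset v.
Proof.
move=> vV; rewrite inE vV; apply/belowP => s sK vs.
by rewrite (setUidPr _) // sub1set.
Qed.

(** A simplex through [f v] is pulled back by the inverse [g] to one through [v], enlarged by [w],
    and pushed forward; [f \o g] fixes the original simplex because its elements are vertices. *)
Lemma below_aut (f : T -> T) (v w : T) :
    simplicial_automorphism K f -> v \in vertices K ->
  below v w -> below (f v) (f w).
Proof.
move=> [fK [g [gK fgK gfK]]] vV /belowP vw; apply/belowP => s sK fvs.
have vgs : v \in g @: s by rewrite -(fgK _ vV) imset_f.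
have := fK _ (vw _ (gK _ sK) vgs); rewrite imsetU1 -imset_comp.
suff -> : (f \o g) @: s = s by [].
rewrite -[RHS]imset_id; apply: eq_in_imset => x xs /=.
by apply: gfK; apply: subsetP xs; apply: simplex_sub_vertices.
Qed.

Lemma card_upset_aut (f : T -> T) (v : T) :
    simplicial_automorphism K f -> v \in vertices K ->
  #|upset v| <= #|upset (f v)|.
Proof.
move=> fA vV; have [fK [g [_ fgK _]]] := fA.
have f_inj : {in upset v &, injective f}.
  move=> x y /setIdP[xV _] /setIdP[yV _] fxy.
  by rewrite -[LHS]fgK // -[RHS]fgK // fxy.
rewrite -(card_in_imset f_inj); apply/subset_leq_card/subsetP.
move=> _ /imsetP[w /setIdP[wV vw] ->]; rewrite !inE below_aut // andbT.
by move: wV; rewrite inE => /fK; rewrite imset_set1.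
Qed.

(** The witness is the apex of the cone. *)
Lemma dominated_below (v : T) :
    dominated K v ->
  exists a, [/\ a \in vertices K, a != v & below v a].
Proof.
move=> [_ [a [M [_ _ lkE]]]]; exists a.
have : [set a] \in link K v by rewrite lkE !inE eqxx.
rewrite inE => /and3P[aK va _].
rewrite inE aK; split=> //; first by rewrite eq_sym -in_set1.
apply/belowP => s sK vs.
suff : a |: (s :\ v) \in link K v.
  by rewrite inE => /and3P[_ _]; rewrite setUCA setD1K.
(* A cone is closed under adding its apex to a simplex; the empty set, not being a simplex, is
   treated apart. *)
rewrite lkE; have [->|sv0] := eqVneq (s :\ v) set0.
  by rewrite setU0 !inE eqxx.
have : s :\ v \in link K v.
  by rewrite inE setD11 setD1K // sK (HK.2 _ _ sK) ?subD1set.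
rewrite lkE => /setUP[/set1P->|].
  by rewrite setUid !inE eqxx.
case/setUP => [tM|/imsetP[t tM ->]].
  by apply/setUP; right; apply/setUP; right; apply: imset_f.
by rewrite setUA setUid; apply/setUP; right; apply/setUP; right; apply: imset_f.
Qed.

Lemma upset_full_simplex (v : T) :
  v \in vertices K -> upset v = vertices K -> is_simplex K.
Proof.
move=> vV vE.
have : [exists s, (s \in K) && (v \in s)].
  by apply/existsP; exists [set v]; rewrite set11 andbT; move: vV; rewrite inE.
(* An inclusion-maximal simplex through [v] contains every [w] above [v], since adding [w] gives
   another simplex through [v]. *)
case/existsP => s0 /(@maxset_exists _ (fun s => (s \in K) && (v \in s))).
case=> s /maxsetP[/andP[sK vs] smax] _.
rewrite /is_simplex; suff -> : vertices K = s by [].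
apply/eqP; rewrite eqEsubset simplex_sub_vertices // andbT.
apply/subsetP => w; rewrite -vE inE => /andP[_ /belowP vw].
by rewrite -(smax (w |: s)) ?setU11 ?subsetUr // vw // setU1r.
Qed.

Hypothesis Hhom : vertex_homogeneous K.

Lemma card_upset (v w : T) :
  v \in vertices K -> w \in vertices K -> #|upset v| = #|upset w|.
Proof.
move=> vV wV; apply/eqP; rewrite eqn_leq; apply/andP; split.
  by have [f [fA <-]] := Hhom vV wV; apply: card_upset_aut.
by have [f [fA <-]] := Hhom wV vV; apply: card_upset_aut.
Qed.

Lemma upset_eq (v w : T) :
  v \in vertices K -> w \in upset v -> upset w = upset v.
Proof.
move=> vV; rewrite inE => /andP[wV vw].
apply/eqP; rewrite eqEcard (card_upset vV wV) leqnn andbT.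
apply/subsetP => u; rewrite !inE => /andP[-> wu].
exact: below_trans vw wu.
Qed.

(** The fibres of [upset] partition the vertices, and by symmetry of the preorder the fibre through
    [x] is [upset x] itself, so all blocks have the same size. *)
Lemma card_upset_dvd (v : T) :
  v \in vertices K -> #|upset v| %| #|vertices K|.
Proof.
move=> vV; have partP := preim_partitionP upset (vertices K).
rewrite (card_uniform_partition (n := #|upset v|) _ partP) ?dvdn_mull //.
move=> A /imsetP[x xV ->]; rewrite (card_upset vV xV); apply: eq_card => y.
rewrite [LHS]inE; apply/andP/idP => [[yV /eqP->]|yx]; first exact: upset_refl.
by rewrite (upset_eq xV yx); split=> //; move: yx; rewrite inE => /andP[].
Qed.

End Domination.

Theorem corollary6p10 (T : finType) (K : {set {set T}})
    (HK : is_complex K) (Hhom : vertex_homogeneous K)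
    (Hprime : prime #|vertices K|) :
  minimal_complex K \/ is_simplex K.
Proof.
have [/existsP[v /andP[vV big]]|small] :=
  boolP [exists v, (v \in vertices K) && (1 < #|upset K v|)]; [right|left].
  apply: (upset_full_simplex HK vV); apply/eqP; rewrite eqEcard.
  rewrite {1}/upset setIdE subsetIl /=; have := card_upset_dvd HK Hhom vV.
  by case/(primeP Hprime).2/orP => /eqP E; rewrite E // in big *.
move=> v vdom; have [a [aV av va]] := dominated_below HK vdom.
(* The up-set of [v] contains both [v] and [a], against [small]. *)
case/existsP: small; exists v; rewrite vdom.1.
rewrite (cardsD1 v) upset_refl ?vdom.1 // ltnS card_gt0.
by apply/set0Pn; exists a; rewrite !inE av va andbT; move: aV; rewrite inE.
Qed.
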